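(* Let $t\in\mathbb{N}$ be fixed, and let $H$ be the $3$-uniform hypergraph with $t+3$ vertices and exactly one edge. Then there is a polynomial-time algorithm for the $3$-Bounded Hypergraph $2$-Coloring Problem restricted to $H$-free hypergraphs.
   Context: A hypergraph $G=(V,E)$ consists of a finite vertex set $V=V(G)$ and an edge set $E=E(G)\subseteq 2^{V}\setminus\{\emptyset\}$. It is $k$-uniform if $|e|=k$ for all $e\in E$, and $k$-bounded if $|e|\le k$ for all $e\in E$. For $X\subseteq V(G)$, the induced subhypergraph is $G[X]=(X,\{e\in E(G): e\subseteq X\})$. $G$ is $H$-free if no induced subhypergraph of $G$ is isomorphic to $H$. A set $S\subseteq V(G)$ is stable if no edge $e$ satisfies $e\subseteq S$. A $2$-coloring of $G$ is a function $c:V(G)\to\{1,2\}$ with $c^{-1}(1)$ and $c^{-1}(2)$ both stable; $G$ is $2$-colorable if it has one. The $3$-Bounded Hypergraph $2$-Coloring Problem: given a $3$-bounded hypergraph $G$, decide whether $G$ is $2$-colorable. *)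

(* Defs.v *)
From HB Require Import structures.
From mathcomp Require Import all_boot.
Set Implicit Arguments.
Unset Strict Implicit.
Unset Printing Implicit Defensive.

Record hypergraph := Hypergraph {
  vertex :> finType;
  edges : {set {set vertex}};
  edges_neq0 : set0 \notin edges }.

Definition k_uniform (k : nat) (G : hypergraph) : bool :=
  [forall e in edges G, #|e| == k].

Definition k_bounded (k : nat) (G : hypergraph) : bool :=
  [forall e in edges G, #|e| <= k].

(* The vertex type of G[X] is the subtype of the elements of X, so an edge
   e of G with e \subset X appears as the set of vertices of G[X] whose image
   under val is e. *)
Definition induced_edges (G : hypergraph) (X : {set G}) :
    {set {set {x : G | x \in X}}} :=
  [set e : {set {x : G | x \in X}} | val @: e \in edges G].

Lemma induced_edges_neq0 (G : hypergraph) (X : {set G}) :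
  set0 \notin induced_edges X.
Proof. by rewrite inE imset0 edges_neq0. Qed.

Definition induced (G : hypergraph) (X : {set G}) : hypergraph :=
  Hypergraph (induced_edges_neq0 X).

Definition isomorphic (G H : hypergraph) : Prop :=
  exists f : G -> H, bijective f /\
    forall e : {set G}, (f @: e \in edges H) = (e \in edges G).

Definition hfree (H G : hypergraph) : Prop :=
  forall X : {set G}, ~ isomorphic (induced X) H.

Definition stable (G : hypergraph) (S : {set G}) : bool :=
  [forall e in edges G, ~~ (e \subset S)].

(* The two colors 1 and 2 are the two booleans. *)
Definition two_coloring (G : hypergraph) (c : {ffun G -> bool}) : bool :=
  stable [set x | c x] && stable [set x | ~~ c x].

Definition two_colorable (G : hypergraph) : bool :=
  [exists c : {ffun G -> bool}, two_coloring c].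

(* Model of computation.

   Algorithms are programs of the WHILE language of N. D. Jones
   (Computability and Complexity from a Programming Perspective, 1997):
   imperative programs over finitely many variables that hold binary trees.
   Evaluating a node of an expression costs the full size, as a tree, of the
   value of that node; copying a variable, for instance, costs the size of its
   content. No sharing of subtrees is assumed, the values held at any time are
   no larger than the input and the time spent so far, and time in this model
   and time on Turing machines are polynomially related. *)

Inductive tree := Nil | Cons of tree & tree.

Fixpoint tree_eqb (a b : tree) : bool :=
  match a, b with
  | Nil, Nil => true
  | Cons a1 a2, Cons b1 b2 => tree_eqb a1 b1 && tree_eqb a2 b2
  | _, _ => false
  end.

Lemma tree_eqP : Equality.axiom tree_eqb.
Proof.
elim=> [|a1 IH1 a2 IH2] [|b1 b2] /=; try by constructor.
apply: (iffP andP) => [[/IH1 -> /IH2 ->] //|[<- <-]].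
by split; [apply/IH1 | apply/IH2].
Qed.

HB.instance Definition _ := hasDecEq.Build tree tree_eqP.

Fixpoint tree_size (d : tree) : nat :=
  if d is Cons a b then (tree_size a + tree_size b).+1 else 1.

Inductive expr :=
  | EVar of nat
  | ENil
  | ECons of expr & expr
  | EHd of expr
  | ETl of expr
  | EEq of expr & expr.

Inductive cmd :=
  | Skip
  | Assign of nat & expr
  | Seq of cmd & cmd
  | If of expr & cmd & cmd
  | While of expr & cmd.

Definition store := nat -> tree.

Definition update (s : store) (x : nat) (d : tree) : store :=
  fun y => if y == x then d else s y.

(* Nil stands for false and every other tree for true. *)
Definition tree_of_bool (b : bool) : tree := if b then Cons Nil Nil else Nil.

Fixpoint eval (s : store) (e : expr) : tree :=
  match e with
  | EVar x => s x
  | ENil => Nil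
  | ECons e1 e2 => Cons (eval s e1) (eval s e2)
  | EHd e1 => if eval s e1 is Cons a _ then a else Nil
  | ETl e1 => if eval s e1 is Cons _ b then b else Nil
  | EEq e1 e2 => tree_of_bool (eval s e1 == eval s e2)
  end.

Fixpoint eval_cost (s : store) (e : expr) : nat :=
  tree_size (eval s e) +
  match e with
  | EVar _ | ENil => 0
  | ECons e1 e2 | EEq e1 e2 => eval_cost s e1 + eval_cost s e2
  | EHd e1 | ETl e1 => eval_cost s e1
  end.

(* exec c s n s' : run from the store s, the command c terminates in the store
   s' after time n. *)
Inductive exec : cmd -> store -> nat -> store -> Prop :=
  | exec_skip s : exec Skip s 1 s
  | exec_assign s x e :
      exec (Assign x e) s (eval_cost s e).+1 (update s x (eval s e))
  | exec_seq c1 c2 s s1 s2 n1 n2 :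
      exec c1 s n1 s1 -> exec c2 s1 n2 s2 -> exec (Seq c1 c2) s (n1 + n2).+1 s2
  | exec_if_true e c1 c2 s s1 n :
      eval s e != Nil -> exec c1 s n s1 ->
      exec (If e c1 c2) s (eval_cost s e + n).+1 s1
  | exec_if_false e c1 c2 s s1 n :
      eval s e = Nil -> exec c2 s n s1 ->
      exec (If e c1 c2) s (eval_cost s e + n).+1 s1
  | exec_while_true e c s s1 s2 n1 n2 :
      eval s e != Nil -> exec c s n1 s1 -> exec (While e c) s1 n2 s2 ->
      exec (While e c) s (eval_cost s e + n1 + n2).+1 s2
  | exec_while_false e c s :
      eval s e = Nil -> exec (While e c) s (eval_cost s e).+1 s.

Lemma exec_deterministic c s n s' m s'' :
  exec c s n s' -> exec c s m s'' -> n = m /\ s' = s''.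
Proof.
move=> ex; elim: ex m s'' => {c s n s'}.
- by move=> s m s'' ex; inversion ex.
- by move=> s x e m s'' ex; inversion ex.
- move=> c1 c2 s s1 s2 n1 n2 _ IH1 _ IH2 m s'' ex.
  inversion ex as [| |? ? ? ? ? ? ? ex1 ex2| | | |]; subst.
  have [? ?] := IH1 _ _ ex1; subst.
  by have [? ?] := IH2 _ _ ex2; subst.
- move=> e c1 c2 s s1 n et _ IH m s'' ex.
  inversion ex as [| | |? ? ? ? ? ? _ ex1|? ? ? ? ? ? ef _| |]; subst.
    by have [? ?] := IH _ _ ex1; subst.
  by rewrite ef in et.
- move=> e c1 c2 s s1 n ef _ IH m s'' ex.
  inversion ex as [| | |? ? ? ? ? ? et _|? ? ? ? ? ? _ ex1| |]; subst.
    by rewrite ef in et.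
  by have [? ?] := IH _ _ ex1; subst.
- move=> e c s s1 s2 n1 n2 et _ IH1 _ IH2 m s'' ex.
  inversion ex as [| | | | |? ? ? ? ? ? ? _ ex1 ex2|? ? ? ef]; subst.
    have [? ?] := IH1 _ _ ex1; subst.
    by have [? ?] := IH2 _ _ ex2; subst.
  by rewrite ef in et.
- move=> e c s ef m s'' ex.
  inversion ex as [| | | | |? ? ? ? ? ? ? et|]; subst=> //.
  by rewrite ef in et.
Qed.

(* The input is in variable 0 and all other variables are initially Nil; the
   answer is read off variable 0. *)
Definition init_store (d : tree) : store := update (fun=> Nil) 0 d.

Definition tree_of_seq (s : seq tree) : tree := foldr Cons Nil s.

Definition tree_of_nat (n : nat) : tree := tree_of_seq (nseq n Nil).

(* d encodes G when it is the pair of the number of vertices, in unary, and of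
   the list of the edges, each edge being a list of vertices. The vertices are
   named 0, 1, ... (in unary) along an arbitrary ordering vs; every edge occurs
   exactly once, in arbitrary order, without repeated vertices. *)
Definition encodes (d : tree) (G : hypergraph) : Prop :=
  exists (vs : seq G) (es : seq (seq G)),
    [/\ perm_eq vs (enum G),
        all uniq es,
        perm_eq [seq [set x in e] | e <- es] (enum (edges G)) &
        d = Cons (tree_of_nat (size vs))
                 (tree_of_seq
                    [seq tree_of_seq [seq tree_of_nat (index x vs) | x <- e]
                    | e <- es])].

(* Some program decides Q on all the inputs that encode a hypergraph
   satisfying P, in time O(N ^ k), where N is the size of the input. Nothing is
   required of the program on other inputs. *)
Definition poly_time_decidable_on (P : hypergraph -> Prop)
    (Q : hypergraph -> bool) : Prop :=
  exists (c : cmd) (a k : nat),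
    forall (G : hypergraph) (d : tree), P G -> encodes d G ->
      exists (n : nat) (s : store),
        [/\ exec c (init_store d) n s,
            n <= a * tree_size d ^ k &
            (s 0 != Nil) = Q G].

(* Main.v *)
From Pilot Require Import Defs.
From mathcomp Require Import all_boot.
From mathcomp Require Import zify.
(* Gives Cons, Nil and Seq back their meaning for trees and commands. *)
Import Pilot.Defs.
Set Implicit Arguments.
Unset Strict Implicit.
Unset Printing Implicit Defensive.

(** Suppose that c is a 2-coloring with at least t vertices of each color, and
    guess a set W i of t vertices in each color class i.  Once these vertices
    are colored, an edge {x, y, w} with w in W i says that x and y do not both
    have color i, and so does an edge {x, y}: such constraints form an instance
    of 2-SAT.  The edges of size 3 that avoid W i seem to be lost, but they are
    implied.  Let e be such an edge with all its vertices colored i.  The set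
    e :|: W i has t + 3 vertices, so H-freeness yields another edge f inside
    it, and f is also entirely colored i.  Either f meets W i or it has size at
    most 2, so f violates one of the 2-SAT constraints
    ([coloring_of_guess]).

    If some color class has fewer than t vertices, it is guessed entirely, and
    all the vertices are then colored; by symmetry this can be assumed to be
    the class of color false.  The same 2-SAT instance decides whether the
    guess is a coloring ([coloring_of_total]).  As t is fixed there are
    polynomially many guesses, and every coloring satisfies the constraints of
    the guesses contained in it ([consistent_of_coloring]), so trying all
    guesses is correct ([solveP]).

    A 2-SAT instance is satisfiable unless some literal and its opposite reach
    each other in the implication graph ([two_sat]), and reachability is
    computed by saturating a list of literals.

    For the running time, commands are analyzed only once and for all: the
    functions from trees to trees that are computed in polynomial time contain
    the basic tree operations and are closed under composition, tests, and iteration over a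
    list as long as the intermediate results have polynomial size
    ([polytime_foldl]).  The algorithm is an ordinary function on trees
    ([solve]), and is polynomial because it is assembled from these closure
    properties ([polytime_solve]). *)

(** * Polynomial bounds *)

Definition poly_bounded (b : tree -> nat) : Prop :=
  exists a k, forall d, b d <= a * tree_size d ^ k.

Lemma tree_size_gt0 d : 0 < tree_size d.
Proof. by case: d. Qed.

Lemma poly_bounded_le b b' :
  (forall d, b d <= b' d) -> poly_bounded b' -> poly_bounded b.
Proof.
by move=> le_b [a [k bnd]]; exists a, k => d; apply: leq_trans (bnd d).
Qed.

Lemma poly_bounded_cst m : poly_bounded (fun=> m).
Proof. by exists m, 0 => d; rewrite muln1. Qed.

Lemma poly_bounded_size : poly_bounded tree_size.
Proof. by exists 1, 1 => d; rewrite mul1n. Qed.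

Lemma poly_bounded_add b1 b2 : poly_bounded b1 -> poly_bounded b2 ->
  poly_bounded (fun d => b1 d + b2 d).
Proof.
move=> [a1 [k1 bnd1]] [a2 [k2 bnd2]]; exists (a1 + a2), (k1 + k2) => d.
have [p1 p2] : 0 < tree_size d ^ k1 /\ 0 < tree_size d ^ k2.
  by rewrite !expn_gt0 tree_size_gt0.
rewrite mulnDl expnD leq_add //.
  by apply: leq_trans (bnd1 d) _; rewrite leq_mul2l leq_pmulr ?orbT.
by apply: leq_trans (bnd2 d) _; rewrite leq_mul2l leq_pmull ?orbT.
Qed.

Lemma poly_bounded_mul b1 b2 : poly_bounded b1 -> poly_bounded b2 ->
  poly_bounded (fun d => b1 d * b2 d).
Proof.
move=> [a1 [k1 bnd1]] [a2 [k2 bnd2]]; exists (a1 * a2), (k1 + k2) => d.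
by rewrite expnD mulnACA leq_mul.
Qed.

Lemma poly_bounded_pow b k : poly_bounded b -> poly_bounded (fun d => b d ^ k).
Proof.
move=> bnd; elim: k => [|k IHk]; first exact: poly_bounded_cst.
apply: poly_bounded_le (poly_bounded_mul bnd IHk) => d.
by rewrite expnS.
Qed.

Lemma poly_bounded_comp b f : poly_bounded (fun d => tree_size (f d)) ->
  poly_bounded b -> poly_bounded (fun d => b (f d)).
Proof.
move=> szf [a [k bnd]].
apply: poly_bounded_le (poly_bounded_mul (poly_bounded_cst a)
  (poly_bounded_pow k szf)) => d.
exact: bnd.
Qed.

(** * Polynomial-time functions on trees *)

(** Time bounds are kept as upper bounds, so that only additions of costs have
    to be followed. *)
Definition runs c s m s' := exists2 n, n <= m & exec c s n s'.

Lemma runs_le c s m1 m2 s' : m1 <= m2 -> runs c s m1 s' -> runs c s m2 s'.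
Proof. by move=> le_m [n le_n ex]; exists n => //; apply: leq_trans le_m. Qed.

Lemma runs_assign s x e :
  runs (Assign x e) s (eval_cost s e).+1 (update s x (eval s e)).
Proof. by exists (eval_cost s e).+1 => //; apply: exec_assign. Qed.

Lemma runs_seq c1 c2 s s1 s2 m1 m2 : runs c1 s m1 s1 -> runs c2 s1 m2 s2 ->
  runs (Seq c1 c2) s (m1 + m2).+1 s2.
Proof.
move=> [n1 le1 ex1] [n2 le2 ex2]; exists (n1 + n2).+1; first by rewrite ltnS leq_add.
exact: exec_seq ex1 ex2.
Qed.

Lemma updatexx s x d : update s x d x = d.
Proof. by rewrite /update eqxx. Qed.

Lemma update_lt s x d y : y < x -> update s x d y = s y.
Proof. by rewrite /update; case: eqP => // ->; rewrite ltnn. Qed.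

Lemma update_gt s x d y : x < y -> update s x d y = s y.
Proof. by rewrite /update; case: eqP => // ->; rewrite ltnn. Qed.

(** A program is given as a family indexed by a base variable b: [C b] reads its
    argument in variable b, leaves its result there, and may overwrite any
    variable above b but none below.  Subprograms are thus composed by giving
    them larger bases, without renaming, and nothing is assumed of the initial
    contents of the variables above b. *)
Definition computes (C : nat -> cmd) (f : tree -> tree) (T : tree -> nat) :=
  forall b s, exists s', [/\ runs (C b) s (T (s b)) s', s' b = f (s b)
    & forall y, y < b -> s' y = s y].

(** The bound on the size of the result is part of the definition because the
    cost of a composition depends on it. *)
Definition polytime (f : tree -> tree) : Prop :=
  exists C T, [/\ poly_bounded T, poly_bounded (fun d => tree_size (f d))
    & computes C f T].

Definition polytime_test (p : tree -> bool) : Prop :=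
  polytime (fun d => tree_of_bool (p d)).

Lemma polytime_eq f g : f =1 g -> polytime f -> polytime g.
Proof.
move=> fg [C [T [pT pf cf]]]; exists C, T; split=> //.
  by apply: poly_bounded_le pf => d; rewrite fg.
by move=> b s; have [s' [r v fr]] := cf b s; exists s'; split; rewrite // -fg.
Qed.

Lemma polytime_test_eq p q : p =1 q -> polytime_test p -> polytime_test q.
Proof. by move=> pq; apply: polytime_eq => d; rewrite pq. Qed.

Lemma polytime_comp g f : polytime g -> polytime f ->
  polytime (fun d => g (f d)).
Proof.
move=> [Cg [Tg [pTg pg cg]]] [Cf [Tf [pTf pf cf]]].
exists (fun b => Seq (Cf b) (Cg b)), (fun d => (Tf d + Tg (f d)) + 1); split.
- apply: poly_bounded_add (poly_bounded_cst 1).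
  exact: poly_bounded_add pTf (poly_bounded_comp pf pTg).
- exact: (poly_bounded_comp (b := fun d => tree_size (g d))).
move=> b s; have [s1 [r1 v1 fr1]] := cf b s; have [s2 [r2 v2 fr2]] := cg b s1.
exists s2; split=> [||y lt_yb]; last by rewrite fr2 // fr1.
  by rewrite addn1; apply: runs_seq r1 _; rewrite -v1.
by rewrite v2 v1.
Qed.

(** T also bounds the size of the result, since evaluating an expression costs
    at least the size of its value. *)
Lemma polytime_assign (E : nat -> expr) f T :
  (forall b s, eval s (E b) = f (s b)) ->
  (forall b s, eval_cost s (E b) <= T (s b)) -> poly_bounded T -> polytime f.
Proof.
move=> ev cost pT; exists (fun b => Assign b (E b)), (fun d => T d + 1); split.
- exact: poly_bounded_add pT (poly_bounded_cst 1).
- apply: poly_bounded_le pT => d; apply: leq_trans (cost 0 (fun=> d)).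
  by rewrite -(ev 0 (fun=> d)); case: (E 0) => *; rewrite /= leq_addr.
move=> b s; exists (update s b (f (s b))); split; last 1 first.
- by move=> y; apply: update_lt.
- by rewrite -ev; apply: runs_le (runs_assign _ _ _); rewrite addn1 ltnS.
- exact: updatexx.
Qed.

Definition thd d := if d is Cons a _ then a else Nil.
Definition ttl d := if d is Cons _ b then b else Nil.

Lemma thd_size d : tree_size (thd d) <= tree_size d.
Proof. by case: d => //= a b; lia. Qed.

Lemma ttl_size d : tree_size (ttl d) <= tree_size d.
Proof. by case: d => //= a b; lia. Qed.

Lemma tree_of_bool_size b : tree_size (tree_of_bool b) <= 3.
Proof. by case: b. Qed.

Lemma polytime_id : polytime id.
Proof.
apply: (polytime_assign (E := EVar) (T := tree_size)) poly_bounded_size => //.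
by move=> b s /=; rewrite addn0.
Qed.

Lemma polytime_Nil : polytime (fun=> Nil).
Proof.
by apply: (polytime_assign (E := fun=> ENil) (T := fun=> 1)) (poly_bounded_cst 1).
Qed.

Lemma polytime_thd f : polytime f -> polytime (fun d => thd (f d)).
Proof.
apply: polytime_comp.
apply: (polytime_assign (E := fun b => EHd (EVar b))
  (T := fun d => tree_size d + tree_size d)) => //.
  by move=> b s /=; have:= thd_size (s b); rewrite /thd; lia.
exact: poly_bounded_add poly_bounded_size poly_bounded_size.
Qed.

Lemma polytime_ttl f : polytime f -> polytime (fun d => ttl (f d)).
Proof.
apply: polytime_comp.
apply: (polytime_assign (E := fun b => ETl (EVar b))
  (T := fun d => tree_size d + tree_size d)) => //.
  by move=> b s /=; have:= ttl_size (s b); rewrite /ttl; lia.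
exact: poly_bounded_add poly_bounded_size poly_bounded_size.
Qed.

Definition call (C : nat -> cmd) x b := Seq (Assign x (EVar b)) (C x).

Lemma computes_call C f T x b s : computes C f T -> b < x ->
  exists s', [/\ runs (call C x b) s (tree_size (s b) + T (s b) + 2) s',
    s' x = f (s b) & forall y, y < x -> s' y = s y].
Proof.
move=> cf lt_bx; have [s' []] := cf x (update s x (s b)).
rewrite updatexx => r v fr; exists s'; split=> // [|y lt_yx].
  apply: runs_le (runs_seq (runs_assign s x (EVar b)) r).
  by rewrite /=; lia.
by rewrite fr ?update_lt.
Qed.

Lemma polytime_Cons f g : polytime f -> polytime g ->
  polytime (fun d => Cons (f d) (g d)).
Proof.
move=> [Cf [Tf [pTf pf cf]]] [Cg [Tg [pTg pg cg]]].
exists (fun b => Seq (call Cf b.+1 b) (Seq (call Cg b.+2 b)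
  (Assign b (ECons (EVar b.+1) (EVar b.+2))))).
exists (fun d => (tree_size d + Tf d) + (tree_size d + Tg d) +
  2 * (tree_size (f d) + tree_size (g d)) + 8).
have psz := poly_bounded_size; have pc m := poly_bounded_cst m; split.
- apply: poly_bounded_add (pc 8).
  apply: poly_bounded_add (poly_bounded_mul (pc 2) (poly_bounded_add pf pg)).
  by apply: poly_bounded_add; apply: poly_bounded_add.
- apply: poly_bounded_le (poly_bounded_add (poly_bounded_add pf pg) (pc 1)) => d.
  by rewrite /= addn1.
move=> b s; have [s1 [r1 v1 fr1]] := computes_call s cf (ltnSn b).
have [s2 [r2 v2 fr2]] := computes_call s1 cg (ltnW (ltnSn b.+1)).
rewrite fr1 // in r2 v2; move: (fr2 _ (ltnSn b.+1)); rewrite v1 => v12.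
have r3 := runs_assign s2 b (ECons (EVar b.+1) (EVar b.+2)).
exists (update s2 b (Cons (f (s b)) (g (s b)))); split; last 1 first.
- by move=> y lt_yb; rewrite update_lt // fr2 ?fr1 //; lia.
- move: r3; rewrite /= v12 v2 => r3.
  by apply: runs_le (runs_seq r1 (runs_seq r2 r3)); lia.
- exact: updatexx.
Qed.

Lemma polytime_test_eqtree f g : polytime f -> polytime g ->
  polytime_test (fun d => f d == g d).
Proof.
move=> pf pg; apply: (polytime_comp (g := fun d => tree_of_bool (thd d == ttl d)))
  (polytime_Cons pf pg).
apply: (polytime_assign (E := fun b => EEq (EHd (EVar b)) (ETl (EVar b)))
  (T := fun d => 3 + 4 * tree_size d)) => //.
  move=> b s /=; have := tree_of_bool_size (thd (s b) == ttl (s b)).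
  by have := thd_size (s b); have := ttl_size (s b); rewrite /thd /ttl; lia.
apply: poly_bounded_add; first exact: poly_bounded_cst.
exact: poly_bounded_mul (poly_bounded_cst 4) poly_bounded_size.
Qed.

Lemma polytime_if p f g : polytime_test p -> polytime f -> polytime g ->
  polytime (fun d => if p d then f d else g d).
Proof.
move=> [Cp [Tp [pTp pp cp]]] [Cf [Tf [pTf pf cf]]] [Cg [Tg [pTg pg cg]]].
exists (fun b => Seq (call Cp b.+1 b) (If (EVar b.+1) (Cf b) (Cg b))).
exists (fun d => tree_size d + Tp d + (Tf d + Tg d) + 7).
have psz := poly_bounded_size; have pc m := poly_bounded_cst m; split.
- apply: poly_bounded_add (pc 7).
  by apply: poly_bounded_add; apply: poly_bounded_add.
- apply: poly_bounded_le (poly_bounded_add pf pg) => d.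
  by case: (p d); lia.
move=> b s; have [s1 [r1 v1 fr1]] := computes_call s cp (ltnSn b).
case def_p: (p (s b)) v1 => v1.
  have [s2 [[n le_n ex] v2 fr2]] := cf b s1; rewrite fr1 // in le_n v2.
  exists s2; split=> //; last by move=> y lt_yb; rewrite fr2 ?fr1 //; lia.
  have r2 : runs (If (EVar b.+1) (Cf b) (Cg b)) s1 (Tf (s b) + 4) s2.
    exists (eval_cost s1 (EVar b.+1) + n).+1; first by rewrite /= v1 /=; lia.
    by apply: exec_if_true; rewrite // [eval _ _]v1.
  by apply: runs_le (runs_seq r1 r2); lia.
have [s2 [[n le_n ex] v2 fr2]] := cg b s1; rewrite fr1 // in le_n v2.
exists s2; split=> //; last by move=> y lt_yb; rewrite fr2 ?fr1 //; lia.
have r2 : runs (If (EVar b.+1) (Cf b) (Cg b)) s1 (Tg (s b) + 4) s2.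
  exists (eval_cost s1 (EVar b.+1) + n).+1; first by rewrite /= v1 /=; lia.
  exact: exec_if_false.
by apply: runs_le (runs_seq r1 r2); lia.
Qed.

Lemma polytime_test_cst c : polytime_test (fun=> c).
Proof.
case: c; last exact: polytime_Nil.
exact: polytime_Cons polytime_Nil polytime_Nil.
Qed.

Lemma polytime_test_neg p : polytime_test p -> polytime_test (fun d => ~~ p d).
Proof.
move=> pp; have tt := polytime_test_cst true.
apply: polytime_eq (polytime_if pp (polytime_test_cst false) tt) => d.
by case: (p d).
Qed.

Lemma polytime_test_and p q : polytime_test p -> polytime_test q ->
  polytime_test (fun d => p d && q d).
Proof.
move=> pp pq.
apply: polytime_eq (polytime_if pp pq (polytime_test_cst false)) => d.
by case: (p d).
Qed.

Lemma polytime_test_or p q : polytime_test p -> polytime_test q ->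
  polytime_test (fun d => p d || q d).
Proof.
move=> pp pq.
apply: polytime_eq (polytime_if pp (polytime_test_cst true) pq) => d.
by case: (p d).
Qed.

(** * Iteration over lists *)

(** Every tree is the encoding of exactly one list of trees. *)
Fixpoint list_of d := if d is Cons x d' then x :: list_of d' else [::].

Lemma tree_of_seqK : cancel tree_of_seq list_of.
Proof. by elim=> //= x s ->. Qed.

Lemma list_ofK : cancel list_of tree_of_seq.
Proof. by elim=> //= x _ d ->. Qed.

Section Fold.
Variables (CF : nat -> cmd) (F : tree -> tree) (a k : nat).
Hypothesis cF : computes CF F (fun d => a * tree_size d ^ k).

(** Variable b holds the parameter e, b + 1 the accumulator z, b + 2 the rest of
    the list, and b + 3 the argument ((e, x), z) of the step, where x is the
    head of the list. *)
Definition fold_body b :=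
  Seq (Assign b.+3 (ECons (ECons (EVar b) (EHd (EVar b.+2))) (EVar b.+1)))
 (Seq (CF b.+3)
 (Seq (Assign b.+1 (EVar b.+3)) (Assign b.+2 (ETl (EVar b.+2))))).

(** Every round costs at most a fixed polynomial in N, since N bounds all the
    trees in use, and the list is shorter than the size of its encoding. *)
Lemma runs_fold_loop b (B L : nat) l s :
    s b.+2 = l -> tree_size l <= L ->
    let f z x := F (Cons (Cons (s b) x) z) in
    (forall l1 l2, list_of l = l1 ++ l2 ->
       tree_size (foldl f (s b.+1) l1) <= B) ->
    let N := tree_size (s b) + L + B + 2 in
  exists s', [/\ runs (While (EVar b.+2) (fold_body b)) s
                   (tree_size l * (12 * N + a * N ^ k)) s',
                 s' b.+1 = foldl f (s b.+1) (list_of l) &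
                 forall y, y <= b -> s' y = s y].
Proof.
elim: l s => [|x _ l IHl] s sl leL f leB N.
  exists s; split=> //; exists (eval_cost s (EVar b.+2)).+1.
    by rewrite /= sl /= /N; lia.
  exact: exec_while_false.
have lez : tree_size (s b.+1) <= B by apply: (leB [::] (x :: list_of l)).
have leFz : tree_size (f (s b.+1) x) <= B by apply: (leB [:: x] (list_of l)).
set d := Cons (Cons (s b) x) (s b.+1) in leFz.
set s1 := update s b.+3 d.
have r1 : runs (Assign b.+3 (ECons (ECons (EVar b) (EHd (EVar b.+2)))
   (EVar b.+1))) s (6 * N) s1.
  have := runs_assign s b.+3 (ECons (ECons (EVar b) (EHd (EVar b.+2)))
     (EVar b.+1)).
  rewrite /= sl; apply: runs_le; rewrite /= /N; move: leL => /=; lia.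
have [s2 [r2 v2 fr2]] := cF b.+3 s1.
rewrite /s1 updatexx in r2 v2.
have ed y : y < b.+3 -> s2 y = s y by move=> lt; rewrite fr2 // /s1 update_lt.
have r3 := runs_assign s2 b.+1 (EVar b.+3).
set s3 := update _ _ _ in r3.
have r4 := runs_assign s3 b.+2 (ETl (EVar b.+2)).
set s4 := update _ _ _ in r4.
have s3l : s3 b.+2 = Cons x l by rewrite /s3 update_gt // ed.
have s4l : s4 b.+2 = l by rewrite /s4 updatexx /= s3l.
have s4y y : y <= b -> s4 y = s y.
  by move=> leb; rewrite /s4 update_lt ?ltnS ?(leqW leb) // /s3 update_lt ?ed //; lia.
have s4z : s4 b.+1 = f (s b.+1) x by rewrite /s4 update_lt // /s3 updatexx /= v2.
have leL' : tree_size l <= L by move: leL => /=; lia.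
have := IHl s4 s4l leL'; rewrite (s4y b) // s4z => -[|s5 [r5 v5 fr5]].
  by move=> l1 l2 def_l; apply: (leB (x :: l1) l2); rewrite /= def_l.
have leT : a * tree_size d ^ k <= a * N ^ k.
  rewrite leq_mul2l; apply/orP; right.
  by case: (k) => // k'; rewrite leq_exp2r // /N /d /=; move: leL => /=; lia.
case: (runs_seq r1 (runs_seq r2 (runs_seq r3 r4))) => n1 le1 ex1.
case: r5 => n5 le5 ex5.
exists s5; split=> [||y le_yb]; last by rewrite fr5 // s4y.
  exists (eval_cost s (EVar b.+2) + n1 + n5).+1; last first.
    by apply: exec_while_true ex1 ex5; rewrite /= sl.
  apply: leq_trans (_ : 12 * N + a * N ^ k + tree_size l * (12 * N + a * N ^ k) <= _).
    rewrite -/N in le5; move: (tree_size l * _) le5 => q5 le5.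
    move: le1; rewrite /= v2 s3l /= sl /=.
    by move: leFz leL leT; rewrite /f -/d /=; rewrite /N; lia.
  by rewrite -mulSn leq_mul2r /=; apply/orP; right; lia.
by rewrite v5.
Qed.
End Fold.

(** Iterating a polynomial-time step may produce results of exponential size;
    the polynomial bound B on the intermediate results excludes this.  The
    parameter e is passed to the step, which makes loops nestable: the
    parameter of an inner loop is a tuple containing those of the outer ones. *)
Lemma polytime_foldl F A L B :
    polytime F -> polytime A -> polytime L -> poly_bounded B ->
    (forall e l1 l2, list_of (L e) = l1 ++ l2 ->
       tree_size (foldl (fun z x => F (Cons (Cons e x) z)) (A e) l1) <= B e) ->
  polytime (fun e =>
    foldl (fun z x => F (Cons (Cons e x) z)) (A e) (list_of (L e))).
Proof.
move=> [CF [TF [[a [k leTF]] _ cF]]] [CA [TA [pTA pA cA]]] [CL [TL [pTL pL cL]]].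
move=> pB leB.
have {}cF : computes CF F (fun d => a * tree_size d ^ k).
  move=> b s; have [s' [r v fr]] := cF b s; exists s'; split=> //.
  exact: runs_le r.
pose M e := tree_size e + tree_size (L e) + B e + 2.
exists (fun b => Seq (call CA b.+1 b) (Seq (call CL b.+2 b)
  (Seq (While (EVar b.+2) (fold_body CF b)) (Assign b (EVar b.+1))))).
exists (fun e => (tree_size e + TA e) + (tree_size e + TL e) +
  tree_size (L e) * (12 * M e + a * M e ^ k) + (B e + 10)).
have psz := poly_bounded_size; have pc m := poly_bounded_cst m; split.
- apply: poly_bounded_add (poly_bounded_add pB (pc _)).
  apply: poly_bounded_add.
    by apply: poly_bounded_add; apply: poly_bounded_add.
  have pM : poly_bounded M.
    apply: poly_bounded_add (pc _); apply: poly_bounded_add pB.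
    exact: poly_bounded_add psz pL.
  apply: poly_bounded_mul pL (poly_bounded_add _ _).
    exact: poly_bounded_mul (pc _) pM.
  exact: poly_bounded_mul (pc _) (poly_bounded_pow k pM).
- apply: poly_bounded_le pB => e; apply: (leB e (list_of (L e)) [::]).
  by rewrite cats0.
move=> b s; set e := s b.
have [s1 [r1 v1 fr1]] := computes_call s cA (ltnSn b).
have [s2 [r2 v2 fr2]] := computes_call s1 cL (ltnW (ltnSn b.+1)).
rewrite fr1 // -/e in r2 v2; move: (fr2 _ (ltnSn b.+1)); rewrite v1 => v12.
have e2 : s2 b = e by rewrite fr2 // fr1.
have := runs_fold_loop (B := B e) cF v2 (leqnn _); rewrite e2 v12.
case=> [l1 l2 /leB // |s3 [r3 v3 fr3]].
have r4 := runs_assign s3 b (EVar b.+1).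
exists (update s3 b (s3 b.+1)); split; last 1 first.
- by move=> y lt_yb; rewrite update_lt // fr3 ?fr2 ?fr1 //; lia.
- apply: runs_le (runs_seq r1 (runs_seq r2 (runs_seq r3 r4))).
  rewrite /= v3; have := leB e (list_of (L e)) [::]; rewrite cats0 => /(_ erefl).
  move: r3 => _; rewrite -/(M e) -/e; lia.
- by rewrite updatexx /= v3.
Qed.

(** * 2-SAT by reachability *)

Section TwoSat.
Variables (L : finType) (neg : L -> L) (imp : rel L).
Hypothesis negK : involutive neg.
Hypothesis imp_contra : forall l m, imp l m -> imp (neg m) (neg l).

Lemma connect_contra l m : connect imp l m -> connect imp (neg m) (neg l).
Proof.
case/connectP=> p; elim: p l => [|x p IHp] l /=; first by move=> _ ->.
case/andP=> lx px def_m; apply: connect_trans (IHp x px def_m) _.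
exact/connect1/imp_contra.
Qed.

(** S is a maximal set of literals that is closed under implication and contains
    no literal with its opposite.  It decides every literal: if l does not
    reach its opposite and neither of the two is in S, then adding to S all
    that l reaches creates no contradiction, because paths can be reversed by
    contraposition. *)
Lemma two_sat :
    (forall l, ~~ (connect imp l (neg l) && connect imp (neg l) l)) ->
  exists S : {set L}, (forall l, (neg l \in S) = (l \notin S)) /\
    (forall l m, l \in S -> imp l m -> m \in S).
Proof.
move=> cons.
pose good (S : {set L}) := [forall l, (l \in S) ==> (neg l \notin S)] &&
  [forall l, forall m, (l \in S) && imp l m ==> (m \in S)].
have [|S /maxsetP[/andP[/forallP consS /'forall_forallP closedS] maxS] _] :=
  @maxset_exists _ good set0 _.
  apply/andP; split; first by apply/forallP=> l; rewrite inE.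
  by apply/'forall_forallP=> l m; rewrite inE.
have closS l m : l \in S -> connect imp l m -> m \in S.
  move=> Sl /connectP[p]; elim: p l Sl => [|x p IHp] l Sl /=; first by move=> _ ->.
  case/andP=> lx; apply: IHp.
  by apply: (implyP (closedS l x)); rewrite Sl.
have full l : ~~ connect imp l (neg l) -> neg l \notin S -> l \in S.
  move=> lnl Snl; pose S' := S :|: [set m | connect imp l m].
  suffices goodS' : good S'.
    by rewrite -(maxS S' goodS' (subsetUl _ _)) !inE connect0 orbT.
  apply/andP; split.
    apply/forallP=> m; apply/implyP; rewrite !inE negb_or => /orP[Sm|lm].
      rewrite (implyP (consS m)) //=; apply: contra Snl => /connect_contra.
      by rewrite negK; apply: closS.
    apply/andP; split.
      by apply: contra Snl => Snm; apply: closS Snm (connect_contra lm).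
    apply: contra lnl => lnm; apply: connect_trans lm _.
    by have := connect_contra lnm; rewrite negK.
  apply/'forall_forallP=> m m'; apply/implyP; rewrite !inE => /andP[/orP[Sm|lm] mm'].
    by rewrite (closS m m') // connect1.
  by rewrite (connect_trans lm (connect1 mm')) orbT.
exists S; split=> [l|l m Sl lm]; last by apply: (implyP (closedS l m)); rewrite Sl.
apply/idP/idP=> [Snl|Sl].
  by apply: contraL Snl => /(implyP (consS l)).
have := cons l; rewrite negb_and => /orP[lnl|nll].
  by apply: contraR Sl => Snl; apply: full.
by apply: full; rewrite ?negK.
Qed.
End TwoSat.

(** * Colorings extending a guess *)

Section Coloring.
Variable G : hypergraph.
Implicit Types (W : bool -> {set G}) (c : {ffun G -> bool}).

(** The literal (x, i) stands for x having color i, and W i is the set of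
    vertices whose color is guessed to be i.  The first disjunct is the
    constraint that an edge inside x, y and W i is not entirely colored i; with
    x = y it covers the edges with one vertex outside W i.  In the second one,
    a guessed vertex of the wrong color implies its guessed color. *)
Definition forces W (l m : G * bool) : bool :=
  (l.2 != m.2) &&
  ([exists e in edges G, e \subset l.1 |: (m.1 |: W l.2)] ||
   (l.1 == m.1) && (l.1 \in W m.2)).

Definition consistent W : bool :=
  [forall v, ~~ (connect (forces W) (v, false) (v, true) &&
                 connect (forces W) (v, true) (v, false))].

Definition opposite (l : G * bool) := (l.1, ~~ l.2).

Lemma forces_contra W l m :
  forces W l m -> forces W (opposite m) (opposite l).
Proof.
case: l m => [x i] [y j]; rewrite /forces /=.
case/andP=> ij; have ji : j = ~~ i by case: i j ij => [] [].
rewrite {}ji negbK in ij *; rewrite setUCA eq_sym ij (eq_sym y) /=.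
by case: (x =P y) => // ->.
Qed.

Lemma two_coloringP c :
  reflect (forall (e : {set G}) i, e \in edges G -> ~~ [forall x in e, c x == i])
          (two_coloring c).
Proof.
have mono (e : {set G}) i :
    [forall x in e, c x == i] = (e \subset [set x | c x == i]).
  apply/forall_inP/subsetP=> h x /h; first by rewrite inE.
  by rewrite inE.
have setE i : [set x | c x == i] = (if i then [set x | c x] else [set x | ~~ c x]).
  by case: i; apply/setP=> x; rewrite !inE; case: (c x).
apply: (iffP andP) => [[/forall_inP st /forall_inP sf] e i Ge|h].
  by rewrite mono setE; case: i; [apply: st | apply: sf].
by split; apply/forall_inP=> e Ge;
  [have := h e true Ge | have := h e false Ge]; rewrite mono setE.
Qed.

Lemma consistent_of_coloring W c : two_coloring c ->
  (forall i, {in W i, forall x, c x = i}) -> consistent W.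
Proof.
move=> /two_coloringP cG cW.
have cF l m : c l.1 = l.2 -> forces W l m -> c m.1 = m.2.
  case: l m => [x i] [y j] /= cx /andP[/= ij].
  case/orP=> [/exists_inP[e Ge sub]|/andP[/eqP <- /cW //]].
  have := cG e i Ge; apply: contraNeq => cy.
  have {}cy : c y = i by case: i j (c y) ij cy {cx sub} => [] [] [].
  apply/forall_inP=> z /(subsetP sub).
  by rewrite !inE => /or3P[/eqP->|/eqP->|/cW ->]; rewrite ?cx ?cy.
have cC l m : c l.1 = l.2 -> connect (forces W) l m -> c m.1 = m.2.
  move=> cl /connectP[p]; elim: p l cl => [|x p IHp] l cl /=; first by move=> _ ->.
  by case/andP=> /(cF _ _ cl)/IHp.
apply/forallP=> v; apply/negP=> /andP[/cC ft /cC tf]; move: ft tf => /=.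
by case: (c v) => [_ /(_ erefl)|/(_ erefl)].
Qed.

(** A satisfying assignment only avoids the edges that are seen by the
    constraints; how far this is from a coloring depends on the guess. *)
Lemma coloring_of_consistent W : consistent W ->
  exists c, [/\ (forall i, {in W i, forall x, c x = i}) &
    forall e i x y, e \in edges G -> e \subset x |: (y |: W i) ->
      ~ (c x = i /\ c y = i)].
Proof.
move/forallP=> cons; have opK : involutive opposite.
  by move=> [x i]; rewrite /opposite /= negbK.
have [|S [negS closS]] := two_sat opK (@forces_contra W).
  move=> [x [|]]; rewrite /opposite //=.
  by rewrite andbC.
have cE x i : ([ffun x => (x, true) \in S] x = i) <-> ((x, i) \in S).
  rewrite ffunE; case: i => //; have := negS (x, true); rewrite /opposite /= => ->.
  by split=> [->|/negbTE].
exists [ffun x => (x, true) \in S]; split.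
  move=> i x Wx; apply/cE; apply: contraLR (isT) => Sx.
  case/negP: (Sx); apply: (closS (x, ~~ i)); first by rewrite (negS (x, i)).
  by rewrite /forces /= eqxx Wx orbT andbT; case: (i).
move=> e i x y Ge sub [/cE Sx /cE Sy].
suffices : (y, ~~ i) \in S by rewrite (negS (y, i)) Sy.
apply: (closS _ _ Sx); rewrite /forces /=; apply/andP; split; first by case: (i).
by apply/orP; left; apply/exists_inP; exists e.
Qed.

(** When the guess colors all the vertices, an edge with a single color i lies in
    W i and is seen by the constraints. *)
Lemma coloring_of_total W : (forall i, W (~~ i) = ~: W i) ->
  consistent W -> two_colorable G.
Proof.
move=> WC /coloring_of_consistent[c [cW cE]].
apply/existsP; exists c; apply/two_coloringP=> e i Ge; apply/negP=> /forall_inP ei.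
have [e0|[x ex]] := set_0Vmem e; first by have := edges_neq0 G; rewrite -e0 Ge.
have sub : e \subset W i.
  apply/subsetP=> y /ei/eqP cy; apply: contraT; rewrite -in_setC -WC => /cW.
  by rewrite cy; case: (i).
have cx := eqP (ei x ex); case: (cE e i x x Ge) => //.
by rewrite (subset_trans sub) // setUA subsetUr.
Qed.

(** The consequence of H-freeness that the algorithm relies on, in terms of
    vertex sets of G rather than isomorphisms. *)
Definition no_sparse_triple (t : nat) :=
  forall (e W : {set G}), e \in edges G -> #|e| = 3 -> #|W| = t ->
    [disjoint e & W] ->
  exists2 f, f \in edges G & (f != e) && (f \subset e :|: W).

Lemma card_le2_subset (e : {set G}) : #|e| <= 2 -> e != set0 ->
  exists x y, [/\ x \in e, y \in e & e \subset [set x; y]].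
Proof.
move=> e2 /set0Pn[x ex]; have [e1|[y]] := set_0Vmem (e :\ x).
  exists x, x; split=> //; apply/subsetP=> z ez; rewrite !inE orbb.
  by apply: contraT => zx; rewrite -(in_set0 z) -e1 !inE zx.
rewrite !inE => /andP[yx ey]; exists x, y; split=> //.
apply/subsetP=> z ez; apply: contraLR e2; rewrite !inE negb_or => /andP[zx zy].
rewrite -ltnNge (cardsD1 x) ex (cardsD1 y) !inE yx ey (cardsD1 z).
by rewrite !inE zx zy ez.
Qed.

(** The edges of size 3 disjoint from W i take care of themselves: if one of them
    is entirely colored i, some other edge within it and W i is as well, and
    this one is seen by the constraints. *)
Lemma coloring_of_guess t W : k_bounded 3 G -> no_sparse_triple t ->
  (forall i, #|W i| = t) -> consistent W -> two_colorable G.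
Proof.
move=> /forall_inP G3 Gt Wt /coloring_of_consistent[c [cW cE]].
apply/existsP; exists c; apply/two_coloringP=> e i Ge; apply/negP=> /forall_inP ei.
(* A monochromatic edge escapes the constraints only if it is a triple
   disjoint from W i. *)
have easy f : f \in edges G -> {in f, forall x, c x = i} ->
    (#|f| == 3) && [disjoint f & W i].
  move=> Gf fi; apply: contraT; rewrite negb_and => nf.
  have f0 : f != set0 by apply: contraTneq Gf => ->; apply: edges_neq0.
  suffices [x [y [fx fy fsub]]] : exists x y,
      [/\ x \in f, y \in f & f \subset x |: (y |: W i)].
    by case: (cE f i x y Gf fsub); split; apply: fi.
  have small (g : {set G}) : #|g| <= 2 -> g != set0 -> g \subset f ->
      f :\: W i \subset g -> exists x y,
      [/\ x \in f, y \in f & f \subset x |: (y |: W i)].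
    move=> g2 g0 /subsetP gf fg; have [x [y [gx gy gsub]]] := card_le2_subset g2 g0.
    exists x, y; split; [exact: gf | exact: gf |].
    apply/subsetP=> z fz; rewrite !inE; case Wz: (z \in W i); first by rewrite !orbT.
    have /(subsetP gsub) : z \in g by apply: (subsetP fg); rewrite inE Wz.
    by rewrite !inE orbF.
  case: (leqP #|f| 2) => f2.
    by apply: (small f) => //; apply: subsetDl.
  have f3 : #|f| = 3 by apply/eqP; rewrite eqn_leq f2 G3.
  move: nf; rewrite f3 eqxx /= => /pred0Pn[z /andP[/= fz Wz]].
  apply: (small (f :\ z)).
  - by move: f3; rewrite (cardsD1 z) fz add1n => -[->].
  - by rewrite -card_gt0; move: f3; rewrite (cardsD1 z) fz add1n => -[->].
  - exact: subsetDl.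
  - apply/subsetP=> y; rewrite !inE => /andP[Wy ->]; rewrite andbT.
    by apply: contraNneq Wy => ->.
have ci x : x \in e -> c x = i by move/ei/eqP.
have /andP[/eqP e3 eW] := easy e Ge ci.
have [f Gf /andP[fe fsub]] := Gt e (W i) Ge e3 (Wt i) eW.
have /andP[/eqP f3 fW] : (#|f| == 3) && [disjoint f & W i].
  by apply: easy => // x /(subsetP fsub); rewrite inE => /orP[/ci|/cW].
case/eqP: fe; apply/eqP; rewrite eqEcard f3 e3 andbT.
apply/subsetP=> x fx; have := subsetP fsub x fx; rewrite inE => /orP[//|Wx].
by have := disjointFr fW fx; rewrite Wx.
Qed.

End Coloring.

(** * Edges of an H-free hypergraph *)

(** Enumerating first the set and then its complement on both sides matches the
    two sets and their complements. *)
Lemma bij_mapping_set (A B : finType) (S : {set A}) (R : {set B}) :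
  #|A| = #|B| -> #|S| = #|R| -> exists2 f : A -> B, bijective f & f @: S = R.
Proof.
move=> eAB eSR.
have eC : #|~: S| = #|~: R|.
  by apply/eqP; rewrite -(eqn_add2l #|S|) cardsC eSR cardsC eAB.
have [B0|[b0 _]] := set_0Vmem [set: B].
  have A0 : #|A| = 0 by rewrite eAB -cardsT B0 cards0.
  have nA (x : A) : False by have := card0_eq A0 x.
  exists (fun x => match nA x with end).
    apply: inj_card_bij => [x|]; [by case: (nA x) | by rewrite eAB].
  by apply/setP=> y; have := in_setT y; rewrite B0 inE.
pose sA := enum S ++ enum (~: S); pose sB := enum R ++ enum (~: R).
have memA x : x \in sA by rewrite mem_cat !mem_enum inE orbN.
have szAB : size sA = size sB by rewrite !size_cat -!cardE eSR eC.
have uniqB : uniq sB.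
  rewrite cat_uniq !enum_uniq andbT /=; apply/hasPn=> x; rewrite !mem_enum inE.
  by [].
pose f x := nth b0 sB (index x sA).
have injf : injective f.
  move=> x y /eqP; rewrite nth_uniq // -?szAB ?index_mem // => /eqP.
  exact: index_inj.
exists f; first by apply: inj_card_bij; rewrite // eAB.
apply/eqP; rewrite eqEcard card_imset // eSR leqnn andbT.
apply/subsetP=> y /imsetP[x Sx ->]; rewrite /f.
have ltx : index x sA < size (enum S).
  by rewrite index_cat mem_enum Sx index_mem mem_enum.
by rewrite nth_cat -[size _]cardE -eSR cardE ltx -mem_enum mem_nth // -cardE -eSR cardE.
Qed.

(** Otherwise e and W span t + 3 vertices with the single edge e, and mapping e
    to the edge of H by a bijection gives an isomorphism. *)
Lemma hfree_excludes (H G : hypergraph) t :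
  k_uniform 3 H -> #|H| = t + 3 -> #|edges H| = 1 -> hfree H G ->
  no_sparse_triple G t.
Proof.
move=> /forall_inP H3 Ht /eqP/cards1P[h defH] Hfree e W Ge e3 Wt eW.
apply/exists_inP; apply: contraT => /exists_inPn none; exfalso.
apply: (Hfree (e :|: W)); set X := e :|: W.
have cX : #|{: {x : G | x \in X}}| = #|H|.
  by rewrite card_sig /X cardsU (disjoint_setI0 eW) cards0 subn0 e3 Wt Ht addnC.
pose e' := [set x : {x : G | x \in X} | val x \in e].
have val_e' : val @: e' = e.
  apply/setP=> x; apply/imsetP/idP=> [[x' + ->]|ex]; first by rewrite inE.
  have Xx : x \in X by rewrite inE ex.
  by exists (exist _ x Xx); rewrite ?inE.
have e'3 : #|e'| = #|h|.
  rewrite -(card_imset _ val_inj) val_e' e3; apply/esym/eqP/H3.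
  by rewrite defH set11.
have [f bijf fe'] := bij_mapping_set cX e'3.
exists f; split=> // d; rewrite defH !inE -fe' (inj_eq (imset_inj (bij_inj bijf))).
apply/eqP/idP=> [->|Gd]; first by rewrite val_e'.
apply: (imset_inj val_inj); rewrite val_e'; apply/eqP; apply: contraT => de.
have := none _ Gd; rewrite de /=; case/negP.
by apply/subsetP=> y /imsetP[x _ ->]; apply: valP.
Qed.

(** Gives access to the outer parameters under one more binder. *)
Lemma polytime_shift f : polytime f -> polytime (fun d => f (thd d)).
Proof. by move=> pf; apply: polytime_comp pf _; apply/polytime_thd/polytime_id. Qed.

Lemma polytime_rev L : polytime L ->
  polytime (fun d => tree_of_seq (rev (list_of (L d)))).
Proof.
move=> pL.
have catrevE l z : foldl (fun z x => Cons x z) z l = tree_of_seq (catrev l (list_of z)).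
  by elim: l z => [|x l IHl] z /=; rewrite ?list_ofK // IHl.
pose F d := Cons (ttl (thd d)) (ttl d).
have pF : polytime F.
  by apply: polytime_Cons; do 2?[apply: polytime_ttl]; [apply: polytime_thd|];
     exact: polytime_id.
have size_cat l1 l2 : tree_size (tree_of_seq l1) <= tree_size (tree_of_seq (l1 ++ l2)).
  elim: l1 => [|x l1 IHl] /=; [exact: tree_size_gt0 | by lia].
have size_rev l : tree_size (tree_of_seq (rev l)) = tree_size (tree_of_seq l).
  rewrite /rev; suff: forall z, (tree_size (tree_of_seq (catrev l z))).+1 =
    tree_size (tree_of_seq l) + tree_size (tree_of_seq z).
    by move/(_ [::]); rewrite /=; lia.
  by elim: l => [|x l IHl] z //=; rewrite IHl /=; lia.
have pB : poly_bounded (fun d => tree_size (L d)) by case: pL => C [T []].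
apply: polytime_eq (polytime_foldl pF polytime_Nil pL pB _) => [d|d l1 l2].
  exact: catrevE.
by move=> def_l; rewrite catrevE /= -/(rev l1) size_rev -(list_ofK (L d)) def_l.
Qed.

(** The left fold processes the list from its head; running it on the reversed
    list gives the right fold, whose recursion equation is easier to use. *)
Lemma polytime_foldr F A L B :
    polytime F -> polytime A -> polytime L -> poly_bounded B ->
    (forall e l1 l2, list_of (L e) = l1 ++ l2 ->
       tree_size (foldr (fun x z => F (Cons (Cons e x) z)) (A e) l2) <= B e) ->
  polytime (fun e =>
    foldr (fun x z => F (Cons (Cons e x) z)) (A e) (list_of (L e))).
Proof.
move=> pF pA pL pB leB.
apply: polytime_eq (polytime_foldl pF pA (polytime_rev pL) pB _) => [e|e l1 l2].
  by rewrite tree_of_seqK foldl_rev.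
rewrite tree_of_seqK => def_l.
rewrite -(revK l1) foldl_rev; apply: (leB e (rev l2)).
by rewrite -rev_cat -def_l revK.
Qed.

Lemma polytime_has P L :
    polytime_test (fun d => P (thd d) (ttl d)) -> polytime L ->
  polytime_test (fun d => has (P d) (list_of (L d))).
Proof.
move=> pP pL.
pose F d := if P (thd (thd d)) (ttl (thd d)) then tree_of_bool true else ttl d.
have pF : polytime F.
  apply: polytime_if; last exact/polytime_ttl/polytime_id.
    exact: (polytime_shift pP).
  exact: polytime_test_cst.
have hasE e l : foldr (fun x z => F (Cons (Cons e x) z)) Nil l = tree_of_bool (has (P e) l).
  by elim: l => //= x l ->; rewrite /F /=; case: (P e x).
apply: polytime_eq (polytime_foldr pF polytime_Nil pL (poly_bounded_cst 3) _) => [d|d l1 l2 _].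
  by rewrite hasE.
by rewrite hasE tree_of_bool_size.
Qed.

Lemma polytime_all P L :
    polytime_test (fun d => P (thd d) (ttl d)) -> polytime L ->
  polytime_test (fun d => all (P d) (list_of (L d))).
Proof.
move=> pP pL.
apply: polytime_test_eq (polytime_test_neg (polytime_has (P := fun d x => ~~ P d x)
  (polytime_test_neg pP) pL)) => d.
by rewrite has_predC negbK.
Qed.

Lemma polytime_mem x L : polytime x -> polytime L ->
  polytime_test (fun d => x d \in list_of (L d)).
Proof.
move=> px pL; have p2 := polytime_ttl polytime_id.
apply: polytime_test_eq (polytime_has (P := fun d y => y == x d)
  (polytime_test_eqtree p2 (polytime_shift px)) pL) => d.
exact: has_pred1.
Qed.

Lemma tree_size_filter p s :
  tree_size (tree_of_seq (filter p s)) <= tree_size (tree_of_seq s).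
Proof. by elim: s => //= x s IHs; case: (p x) => /=; lia. Qed.

Lemma polytime_filter P L :
    polytime_test (fun d => P (thd d) (ttl d)) -> polytime L ->
  polytime (fun d => tree_of_seq (filter (P d) (list_of (L d)))).
Proof.
move=> pP pL.
pose F d := if P (thd (thd d)) (ttl (thd d)) then Cons (ttl (thd d)) (ttl d) else ttl d.
have p2 := polytime_ttl polytime_id.
have pF : polytime F.
  apply: polytime_if (p2); first exact: (polytime_shift pP).
  by apply: polytime_Cons (p2); apply: (polytime_shift p2).
have filterE e l : foldr (fun x z => F (Cons (Cons e x) z)) Nil l = tree_of_seq (filter (P e) l).
  by elim: l => //= x l ->; rewrite /F /=; case: (P e x).
have pB : poly_bounded (fun d => tree_size (L d)) by case: pL => C [T []].
apply: polytime_eq (polytime_foldr pF polytime_Nil pL pB _) => [d|d l1 l2 def_l].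
  by rewrite filterE.
rewrite filterE -(list_ofK (L d)) def_l; elim: l1 {def_l} => [|x l1 IHl] /=; last by lia.
exact: tree_size_filter.
Qed.

(** * The algorithm *)

(** Lists the numerals n - 1, ..., 0: the fold builds n, ..., 0 and its head is
    then dropped. *)
Definition vertices n :=
  ttl (foldr (fun _ z => Cons (Cons Nil (thd z)) z) (Cons Nil Nil) (list_of n)).

Definition literals V :=
  foldr (fun v z => Cons (Cons v (tree_of_bool false))
                      (Cons (Cons v (tree_of_bool true)) z)) Nil (list_of V).

(** A guess is a pair of lists, those of the vertices colored false and true. *)
Definition side W c := if c == Nil then thd W else ttl W.

Definition forces_code E W l m :=
  (ttl l != ttl m) &&
  (has (fun e => all (mem (list_of (Cons (thd l) (Cons (thd m) (side W (ttl l))))))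
                   (list_of e)) (list_of E)
   || (thd l == thd m) && (thd l \in list_of (side W (ttl m)))).

Definition reach_step U E W S :=
  tree_of_seq (filter (fun m => (m \in list_of S) ||
      has (fun l => (l \in list_of S) && forces_code E W l m) (list_of U))
    (list_of U)).

(** One saturation step per literal is enough, since a shortest path visits each
    literal at most once; the elements of U only serve to count the steps. *)
Definition reach U E W l :=
  foldr (fun _ S => reach_step U E W S) (Cons l Nil) (list_of U).

Definition consistent_code V E W :=
  all (fun v =>
    let f := Cons v (tree_of_bool false) in let t := Cons v (tree_of_bool true) in
    ~~ ((t \in list_of (reach (literals V) E W f)) &&
        (f \in list_of (reach (literals V) E W t)))) (list_of V).

(** Tries all the ways to extend W by k distinct new vertices.  The number k is
    not an input of the program, which has k nested loops. *)
Fixpoint guess k V (P : tree -> bool) W :=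
  if k is k'.+1 then
    has (fun x => (x \notin list_of W) && guess k' V P (Cons x W)) (list_of V)
  else P W.

Definition complement V W :=
  tree_of_seq (filter (fun x => x \notin list_of W) (list_of V)).

(** The first part tries the colorings with less than t vertices colored
    false. *)
Definition solve t V E :=
  has (fun k => guess k V (fun W0 => consistent_code V E (Cons W0 (complement V W0))) Nil)
      (iota 0 t)
  || guess t V (fun W0 => guess t V (fun W1 => consistent_code V E (Cons W0 W1)) Nil) Nil.

Lemma polytime_vertices n : polytime n -> polytime (fun d => vertices (n d)).
Proof.
move=> pn; apply: polytime_ttl.
pose F d := Cons (Cons Nil (thd (ttl d))) (ttl d).
have p2 := polytime_ttl polytime_id.
have pF : polytime F.
  apply: polytime_Cons (p2); apply: polytime_Cons (polytime_thd p2).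
  exact: polytime_Nil.
have p0 := polytime_Cons polytime_Nil polytime_Nil.
have szn : poly_bounded (fun d => tree_size (n d)) by case: pn => C [T []].
have pB : poly_bounded (fun d => tree_size (n d) * (2 * tree_size (n d) + 5)).
  apply: poly_bounded_mul (szn) (poly_bounded_add _ (poly_bounded_cst 5)).
  exact: poly_bounded_mul (poly_bounded_cst 2) szn.
apply: polytime_eq (polytime_foldr pF p0 pn pB _) => [d //|d l1 l2 def_l].
set r := foldr _ _ l2; have sz_l2 : size l2 < tree_size (n d).
  rewrite -(list_ofK (n d)) def_l; elim: l1 {def_l} => [|x l1 IHl] /=; last by lia.
  by elim: (l2) => //= x l IHl; lia.
suffices [le_r le_hd] : tree_size r <= (size l2).+1 * (2 * size l2 + 5) /\
    tree_size (thd r) <= 2 * size l2 + 1.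
  by apply: leq_trans le_r _; apply: leq_mul => //; lia.
rewrite /r; elim: (l2) => [//|x l [IH1 IH2]] /=.
split; last by move: IH2; lia.
by move: IH1 IH2; move: (foldr _ _ l) => q; lia.
Qed.

Lemma polytime_literals V : polytime V -> polytime (fun d => literals (V d)).
Proof.
move=> pV; pose v d := ttl (thd d).
pose F d := Cons (Cons (v d) (tree_of_bool false))
              (Cons (Cons (v d) (tree_of_bool true)) (ttl d)).
have p2 := polytime_ttl polytime_id; have pv := polytime_shift p2.
have pF : polytime F.
  do 2!apply: polytime_Cons => //; try exact: polytime_test_cst.
  by apply: polytime_Cons pv _; apply: polytime_test_cst.
have szV : poly_bounded (fun d => tree_size (V d)) by case: pV => C [T []].
have pB : poly_bounded (fun d => 8 * tree_size (V d)).
  exact: poly_bounded_mul (poly_bounded_cst 8) szV.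
apply: polytime_eq (polytime_foldr pF polytime_Nil pV pB _) => [d //|d l1 l2 def_l].
rewrite -(list_ofK (V d)) def_l; elim: l1 {def_l} => [|x l1 IHl] /=; last by lia.
by elim: l2 => //= x l2; rewrite /v /=; have := tree_size_gt0 x; lia.
Qed.

Lemma polytime_side W c : polytime W -> polytime c ->
  polytime (fun d => side (W d) (c d)).
Proof.
move=> pW pc; apply: polytime_if; [|exact: polytime_thd|exact: polytime_ttl].
exact: polytime_test_eqtree pc polytime_Nil.
Qed.

Lemma polytime_forces E W l m :
    polytime E -> polytime W -> polytime l -> polytime m ->
  polytime_test (fun d => forces_code (E d) (W d) (l d) (m d)).
Proof.
move=> pE pW pl pm; have [pl1 pl2] := (polytime_thd pl, polytime_ttl pl).
have [pm1 pm2] := (polytime_thd pm, polytime_ttl pm).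
apply: polytime_test_and; first exact/polytime_test_neg/polytime_test_eqtree.
apply: polytime_test_or; last first.
  apply: polytime_test_and; first exact: polytime_test_eqtree.
  exact: polytime_mem (polytime_side pW pm2).
have p2 := polytime_ttl polytime_id.
apply: polytime_has pE; apply: polytime_all (p2).
apply: (polytime_mem (L := fun d => Cons _ (Cons _ (side _ _)))) p2 _.
have pZ := polytime_Cons pl1 (polytime_Cons pm1 (polytime_side pW pl2)).
exact: polytime_shift (polytime_shift pZ).
Qed.

Lemma polytime_reach_step U E W S :
    polytime U -> polytime E -> polytime W -> polytime S ->
  polytime (fun d => reach_step (U d) (E d) (W d) (S d)).
Proof.
move=> pU pE pW pS; have p2 := polytime_ttl polytime_id.
apply: polytime_filter (pU).
apply: polytime_test_or; first exact: polytime_mem p2 (polytime_shift pS).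
apply: (polytime_has (P := fun d l => _)) (polytime_shift pU).
have pSS := polytime_shift (polytime_shift pS).
apply: polytime_test_and; first exact: polytime_mem p2 pSS.
apply: polytime_forces => //.
- exact: polytime_shift (polytime_shift pE).
- exact: polytime_shift (polytime_shift pW).
- exact: polytime_shift p2.
Qed.

Lemma polytime_reach U E W l :
    polytime U -> polytime E -> polytime W -> polytime l ->
  polytime (fun d => reach (U d) (E d) (W d) (l d)).
Proof.
move=> pU pE pW pl; have p2 := polytime_ttl polytime_id.
pose F d := reach_step (U (thd (thd d))) (E (thd (thd d))) (W (thd (thd d))) (ttl d).
have pF : polytime F.
  have pF1 f : polytime f -> polytime (fun d => f (thd (thd d))).
    by move=> pf; apply: polytime_shift (polytime_shift pf).
  exact: polytime_reach_step (pF1 _ pU) (pF1 _ pE) (pF1 _ pW) p2.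
have p0 := polytime_Cons pl polytime_Nil.
have szU : poly_bounded (fun d => tree_size (U d)) by case: pU => C [T []].
have szl : poly_bounded (fun d => tree_size (l d)) by case: pl => C [T []].
have pB : poly_bounded (fun d => tree_size (U d) + (tree_size (l d) + 2)).
  exact: poly_bounded_add szU (poly_bounded_add szl (poly_bounded_cst 2)).
apply: polytime_eq (polytime_foldr pF p0 pU pB _) => [d //|d l1 l2 _].
case: l2 => [|x l2] /=; first by have := tree_size_gt0 (U d); lia.
rewrite /F /=; apply: leq_trans (leq_addr _ _); rewrite /reach_step.
by rewrite -[X in _ <= tree_size X]list_ofK tree_size_filter.
Qed.

Lemma polytime_consistent V E W : polytime V -> polytime E -> polytime W ->
  polytime_test (fun d => consistent_code (V d) (E d) (W d)).
Proof.
move=> pV pE pW; have p2 := polytime_ttl polytime_id.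
apply: polytime_all (pV); apply: polytime_test_neg.
have pl c : polytime (fun d => Cons (ttl d) (tree_of_bool c)).
  exact: polytime_Cons p2 (polytime_test_cst c).
have [pU pE' pW'] := And3 (polytime_shift (polytime_literals pV))
  (polytime_shift pE) (polytime_shift pW).
by apply: polytime_test_and;
   [apply: polytime_mem (pl true) _ | apply: polytime_mem (pl false) _];
   apply: polytime_reach.
Qed.

Lemma polytime_guess k V P W :
    polytime V -> polytime_test (fun d => P (thd d) (ttl d)) -> polytime W ->
  polytime_test (fun d => guess k (V d) (P d) (W d)).
Proof.
elim: k V P W => [|k IHk] V P W pV pP pW /=.
  apply: (polytime_comp pP (f := fun d => Cons d (W d))).
  exact: polytime_Cons polytime_id pW.
have p2 := polytime_ttl polytime_id.
apply: (polytime_has (P := fun d x => _)) (pV); apply: polytime_test_and.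
  by apply: polytime_test_neg; apply: polytime_mem (p2) (polytime_shift pW).
apply: (IHk (fun d => V (thd d)) (fun d => P (thd d))).
- exact: polytime_shift pV.
- apply: (polytime_comp pP (f := fun d => Cons (thd (thd d)) (ttl d))).
  by apply: polytime_Cons (p2); apply: polytime_shift (polytime_thd polytime_id).
- exact: polytime_Cons p2 (polytime_shift pW).
Qed.

Lemma polytime_complement V W : polytime V -> polytime W ->
  polytime (fun d => complement (V d) (W d)).
Proof.
move=> pV pW; have p2 := polytime_ttl polytime_id.
apply: (polytime_filter (P := fun d x => _)) (pV); apply: polytime_test_neg.
exact: polytime_mem p2 (polytime_shift pW).
Qed.

Lemma polytime_solve t V E : polytime V -> polytime E ->
  polytime_test (fun d => solve t (V d) (E d)).
Proof.
move=> pV pE; have p2 := polytime_ttl polytime_id.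
have [pV1 pE1] := (polytime_shift pV, polytime_shift pE).
apply: polytime_test_or.
  elim: (iota 0 t) => [|k s IHs] /=; first exact: polytime_test_cst.
  apply: polytime_test_or IHs.
  apply: (@polytime_guess _ V (fun d x => _) _ pV _ polytime_Nil).
  apply: polytime_consistent => //.
  exact: polytime_Cons p2 (polytime_complement pV1 p2).
apply: (@polytime_guess _ V (fun d x => _) _ pV _ polytime_Nil).
apply: (@polytime_guess _ (fun d => V (thd d)) (fun d x => _) _ pV1 _ polytime_Nil).
apply: polytime_consistent.
- exact: polytime_shift pV1.
- exact: polytime_shift pE1.
- exact: polytime_Cons (polytime_shift p2) p2.
Qed.

Lemma tree_of_nat_inj : injective tree_of_nat.
Proof.
move=> m n /(congr1 (size \o list_of)) /=.
by rewrite !tree_of_seqK !size_nseq.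
Qed.

Lemma tree_of_bool_inj : injective tree_of_bool.
Proof. by case=> [] []. Qed.

Lemma list_of_vertices n :
  list_of (vertices (tree_of_nat n)) = map tree_of_nat (rev (iota 0 n)).
Proof.
have rev_iota m : rev (iota 0 m.+1) = m :: rev (iota 0 m).
  by rewrite -addn1 iotaD rev_cat.
rewrite /vertices [tree_of_nat n]/tree_of_nat tree_of_seqK.
set r := foldr _ _ _.
suff -> : r = tree_of_seq (map tree_of_nat (rev (iota 0 n.+1))).
  by rewrite rev_iota /= tree_of_seqK.
rewrite /r; elim: n {r} => // n IHn.
by rewrite [LHS]/= IHn !rev_iota.
Qed.

(** * Correctness of the algorithm *)

Section Correctness.
Variables (G : hypergraph) (code : G -> tree).
Hypothesis code_inj : injective code.
Definition code_seq (s : seq G) := tree_of_seq (map code s).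
Variables (vs : seq G) (es : seq (seq G)).
Hypothesis mem_vs : forall x, x \in vs.
Hypothesis mem_es : edges G =i [seq [set x in e] | e <- es].
Let V := code_seq vs.
Let E := tree_of_seq (map code_seq es).
Let list_V : list_of V = map code vs := tree_of_seqK _.

Definition code_lit (l : G * bool) := Cons (code l.1) (tree_of_bool l.2).

Lemma code_lit_inj : injective code_lit.
Proof. by move=> [x i] [y j] [/code_inj -> /tree_of_bool_inj ->]. Qed.

Section Guess.
Variable w : bool -> seq G.
Let W := Cons (code_seq (w false)) (code_seq (w true)).
Let Wset c := [set x in w c].

Lemma list_of_side c : list_of (side W (tree_of_bool c)) = map code (w c).
Proof. by case: c; rewrite /side /= tree_of_seqK. Qed.

Lemma forces_codeE l m :
  forces_code E W (code_lit l) (code_lit m) = forces Wset l m.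
Proof.
case: l m => [x i] [y j]; rewrite /forces_code /forces /=.
rewrite (inj_eq tree_of_bool_inj) (inj_eq code_inj) !list_of_side.
rewrite (mem_map code_inj) inE tree_of_seqK has_map.
congr (_ && (_ || _)); apply/hasP/exists_inP => [[e es_e]|[e]].
  rewrite /= tree_of_seqK all_map => /allP sub.
  exists [set x in e]; first by rewrite mem_es map_f.
  apply/subsetP=> z; rewrite !inE => /sub /=.
  by rewrite !inE !(inj_eq code_inj) (mem_map code_inj).
rewrite mem_es => /mapP[s es_s ->] /subsetP sub; exists s => //=.
rewrite tree_of_seqK all_map; apply/allP=> z s_z /=.
rewrite !inE !(inj_eq code_inj) (mem_map code_inj).
by have := sub z; rewrite !inE; apply.
Qed.

Lemma has_literals P :
  has P (list_of (literals V)) = [exists l : G * bool, P (code_lit l)].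
Proof.
have -> : has P (list_of (literals V)) =
    has (fun x => P (code_lit (x, false)) || P (code_lit (x, true))) vs.
  rewrite /literals list_V.
  by elim: (vs) => //= x s ->; rewrite orbA.
apply/hasP/existsP => [[x _ /orP[]]|[[x [] Pl]]]; [by exists (x, false) |
  by exists (x, true) | |]; exists x; by rewrite ?mem_vs ?Pl ?orbT.
Qed.

Lemma mem_literals l : code_lit l \in list_of (literals V).
Proof.
by rewrite -has_pred1 has_literals; apply/existsP; exists l => /=.
Qed.

Lemma mem_reach_step S m : code_lit m \in list_of (reach_step (literals V) E W S) =
  (code_lit m \in list_of S) ||
  [exists l, (code_lit l \in list_of S) && forces Wset l m].
Proof.
rewrite tree_of_seqK mem_filter mem_literals andbT has_literals.
by congr (_ || _); apply: eq_existsb => l; rewrite forces_codeE.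
Qed.

(** A path can be shortened to one without repetition, whose length is less than
    the number of saturation steps. *)
Lemma mem_reach l m :
  (code_lit m \in list_of (reach (literals V) E W (code_lit l))) =
  connect (forces Wset) l m.
Proof.
rewrite /reach; apply/idP/idP.
  elim: (list_of (literals V)) m => [|x s IHs] m.
    by rewrite inE (inj_eq code_lit_inj) => /eqP ->; apply: connect0.
  rewrite [foldr _ _ _]/= mem_reach_step => /orP[/IHs //|/existsP[l' /andP[/IHs ll' l'm]]].
  exact: connect_trans ll' (connect1 l'm).
move=> /connectP[p0 p0P ->]; case: (shortenP p0P) => p pP p_uniq _ {p0P}.
have szp : size p <= size (list_of (literals V)).
  apply: ltnW; rewrite -[_.+1]/(size (l :: p)).
  rewrite -(size_map code_lit); apply: uniq_leq_size.
    by rewrite (map_inj_uniq code_lit_inj).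
  by move=> _ /mapP[l' _ ->]; apply: mem_literals.
elim: (list_of (literals V)) p pP szp {p_uniq} => [|x s IHs] p pP szp.
  by case: p szp {pP} => //=; rewrite inE eqxx.
rewrite [foldr _ _ _]/= mem_reach_step.
case/lastP: p => [|p y] in pP szp *; first by rewrite (IHs [::]).
rewrite last_rcons; apply/orP; right; apply/existsP; exists (last l p).
move: pP szp; rewrite rcons_path size_rcons => /andP[pP ->]; rewrite andbT.
exact: IHs.
Qed.

Lemma consistent_codeE : consistent_code V E W = consistent Wset.
Proof.
pose ok v := ~~ (connect (forces Wset) (v, false) (v, true) &&
                connect (forces Wset) (v, true) (v, false)).
have -> : consistent_code V E W = all ok vs.
  rewrite /consistent_code list_V all_map; apply: eq_all => v.
  congr (~~ (_ && _)).
    exact: mem_reach (v, false) (v, true).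
  exact: mem_reach (v, true) (v, false).
by apply/allP/forallP => [h v|h v _]; apply: h.
Qed.
End Guess.

Lemma guessP k (P : tree -> bool) w : uniq w ->
  reflect (exists u, [/\ size u = k, uniq (u ++ w) & P (code_seq (u ++ w))])
          (guess k V P (code_seq w)).
Proof.
elim: k w => [|k IHk] w uniq_w /=.
  apply: (iffP idP) => [Pw|[u [/size0nil -> //]]].
  by exists [::].
rewrite list_V has_map; apply: (iffP hasP).
  case=> x _ /=; rewrite tree_of_seqK (mem_map code_inj) => /andP[wx].
  case/(IHk (x :: w)); first by rewrite /= wx.
  by move=> u [szu uu Pu]; exists (rcons u x); rewrite size_rcons szu cat_rcons.
case=> u []; case/lastP: u => [//|u x].
rewrite size_rcons cat_rcons => -[szu] uu Pu; exists x => //=.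
have uxw : uniq (x :: w) by move: uu; rewrite cat_uniq => /and3P[].
rewrite tree_of_seqK (mem_map code_inj); case/andP: (uxw) => -> _ /=.
by apply/(IHk (x :: w) uxw); exists u.
Qed.

Lemma complement_code w :
  complement V (code_seq w) = code_seq [seq x <- vs | x \notin w].
Proof.
rewrite /complement list_V tree_of_seqK filter_map; congr (tree_of_seq (map _ _)).
by apply: eq_filter => x /=; rewrite (mem_map code_inj).
Qed.

(** Exchanging the colors of a coloring if necessary, either the class of color
    false has fewer than t vertices or both classes have at least t. *)
Lemma solveP t : k_bounded 3 G -> no_sparse_triple G t ->
  solve t V E = two_colorable G.
Proof.
move=> G3 Gt.
have consE u v : consistent_code V E (Cons (code_seq u) (code_seq v)) =
    consistent (fun c => [set x in if c then v else u]).
  exact: (consistent_codeE (fun c => if c then v else u)).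
apply/orP/idP => [[/hasP[k _ /(@guessP _ _ [::] isT)[u [_ _]]]|]|].
- rewrite cats0 complement_code consE; apply: coloring_of_total => i.
  by apply/setP=> x; case: i; rewrite !inE /= mem_filter mem_vs andbT ?negbK.
- case/(@guessP _ _ [::] isT)=> u [szu +].
  rewrite cats0 => uu /(@guessP _ _ [::] isT)[v [szv]].
  rewrite cats0 consE => uv; apply: coloring_of_guess G3 Gt _ => i.
  rewrite cardsE; case: i.
    by rewrite -szv; apply/card_uniqP.
  by rewrite -szu; apply/card_uniqP.
case/existsP=> c0 c0P.
have [c [cP small]] : exists c : {ffun G -> bool}, two_coloring c /\
    (#|[set x | c x == false]| < t \/ forall i, t <= #|[set x | c x == i]|).
  have [lt0|le0] := ltnP #|[set x | c0 x == false]| t; first by exists c0; auto.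
  have [lt1|le1] := ltnP #|[set x | c0 x == true]| t; last first.
    by exists c0; split=> //; right; case.
  exists [ffun x => ~~ c0 x]; split; last first.
    left; apply: leq_ltn_trans lt1; apply: subset_leq_card; apply/subsetP=> x.
    by rewrite !inE ffunE; case: (c0 x).
  have/two_coloringP h := c0P; apply/two_coloringP => e i Ge.
  apply: contra (h e (~~ i) Ge) => /forall_inP ei; apply/forall_inP=> x /ei.
  by rewrite ffunE; case: (c0 x) i {ei} => [] [].
have consc u v : {in u, forall x, c x = false} -> {in v, forall x, c x = true} ->
    consistent_code V E (Cons (code_seq u) (code_seq v)).
  move=> cu cv; rewrite consE; apply: consistent_of_coloring cP _ => i x.
  by rewrite inE; case: i => [/cv|/cu].
case: small => [lt_t|le_t]; [left | right].
  apply/hasP; exists #|[set x | c x == false]|; first by rewrite mem_iota.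
  apply/(@guessP _ _ [::] isT); exists (enum [set x | c x == false]).
  rewrite cats0 -cardE enum_uniq complement_code; split=> //; apply: consc => x.
    by rewrite mem_enum inE => /eqP.
  by rewrite mem_filter mem_enum inE => /andP[]; case: (c x).
pose u i := take t (enum [set x | c x == i]).
have szu i : size (u i) = t by rewrite size_takel // -cardE.
have uu i : uniq (u i) by rewrite take_uniq // enum_uniq.
have cu i : {in u i, forall x, c x = i}.
  by move=> x /mem_take; rewrite mem_enum inE => /eqP.
apply/(@guessP _ _ [::] isT); exists (u false); rewrite cats0; split=> //.
apply/(@guessP _ _ [::] isT); exists (u true); rewrite cats0; split=> //.
by apply: consc; apply: cu.
Qed.
End Correctness.

Lemma polytime_decides p P Q :
    polytime_test p -> (forall G d, P G -> encodes d G -> p d = Q G) ->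
  poly_time_decidable_on P Q.
Proof.
case=> C [T [[a [k leT]] _ cC]] pQ; exists (C 0), a, k => G d PG dG.
have [s [[n le_n ex] v _]] := cC 0 (init_store d).
exists n, s; split=> //; first exact: leq_trans le_n (leT d).
by rewrite v -(pQ G d PG dG) /init_store updatexx; case: (p d).
Qed.

Theorem theorem1p7 (t : nat) (H : hypergraph)
    (H_uniform : k_uniform 3 H)
    (H_card : #|H| = t + 3)
    (H_one_edge : #|edges H| = 1) :
  poly_time_decidable_on
    (fun G : hypergraph => k_bounded 3 G /\ hfree H G)
    two_colorable.
Proof.
have pid := polytime_id.
apply: polytime_decides (polytime_solve t (polytime_vertices (polytime_thd pid))
  (polytime_ttl pid)) _ => G d [G3 Hfree] [vs [es [vsP _ esP ->]]].
pose code x := tree_of_nat (index x vs).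
have vs_all x : x \in vs by rewrite (perm_mem vsP) mem_enum.
have vs_uniq : uniq vs by rewrite (perm_uniq vsP) enum_uniq.
have code_inj : injective code by move=> x y /tree_of_nat_inj; apply: index_inj.
have -> : vertices (thd (Cons (tree_of_nat (size vs)) _)) = code_seq code (rev vs).
  move=> E; rewrite -[LHS]list_ofK list_of_vertices /code_seq; congr tree_of_seq.
  rewrite !map_rev; congr rev; apply: (@eq_from_nth _ Nil).
    by rewrite !size_map size_iota.
  rewrite size_map size_iota => i ltin.
  case: vs ltin @code {vs_all} vs_uniq {code_inj vsP} => // x0 s ltin code us.
  rewrite (nth_map 0) ?size_iota // (nth_map x0) // nth_iota // add0n /code.
  by rewrite index_uniq.
apply: (solveP code_inj) G3 _.
- by move=> x; rewrite mem_rev.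
- by move=> e; rewrite (perm_mem esP) mem_enum.
- exact: hfree_excludes H_uniform H_card H_one_edge Hfree.
Qed.
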